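(* Let $V:[0,+\infty)\to[0,+\infty)$ be a $C^1$ strictly increasing function with $\lim_{t\to\infty}V(t)=+\infty$, and let $S:=V'$. Let $(X,\mathsf d,\mathfrak m)$ be a metric measure space admitting the generalized asymptotic volume ratio $\mathrm{AVR}^V_{(X,\mathsf d,\mathfrak m)}$ associated to $V$, and suppose there is a constant $k>0$ such that $\mathfrak m(B_r(x))\le k\,V(r)$ for every $x\in X$ and every sufficiently large $r>0$. Let $(\rho_n)_{n\in\mathbb N}$ be mollifiers of radial type satisfying approximation of the identity of radial type associated to $V$. Let $p\ge 1$ and for $u\in L^p(X,\mathfrak m)$ set \[ \mathcal E_n(u):=\iint_{\{(x,y)\in X\times X:\,x\neq y\}}|u(x)-u(y)|^p\rho_n(x,y)\,\mathrm d\mathfrak m(x)\,\mathrm d\mathfrak m(y). \] Then for every $u\in L^p(X,\mathfrak m)$ such that $\mathcal E_{n_0}(u)<+\infty$ for some $n_0\in\mathbb N$, \[ \lim_{n\to\infty}\mathcal E_n(u)=2\,\mathrm{AVR}^V_{(X,\mathsf d,\mathfrak m)}\,\|u\|^p_{L^p}. \]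
   Context: A metric measure space is a triple $(X,\mathsf d,\mathfrak m)$ with $(X,\mathsf d)$ complete and separable and $\mathfrak m$ a locally finite non-negative Borel measure with full support. $(X,\mathsf d,\mathfrak m)$ admits the generalized asymptotic volume ratio associated to $V$ if there is $\mathrm{AVR}^V_{(X,\mathsf d,\mathfrak m)}\in[0,+\infty]$ such that for every $x_0\in X$, $\mathrm{AVR}^V_{(X,\mathsf d,\mathfrak m)}=\lim_{r\to+\infty}\mathfrak m(B_r(x_0))/V(r)$. Functions $\rho_n$ on $\{(x,y):x\neq y\}$ satisfy approximation of the identity of radial type associated to $V$ if there is a sequence of strictly decreasing functions $\tilde\rho_n\in C^1(0,+\infty)$ such that: (i) $\lim_{n\to\infty}\tilde\rho_n(r)=0$ for all $r>0$; $\lim_{r\to+\infty}\tilde\rho_n(r)V(r)=0$ for all $n$; and $\rho_n(x,y)=\tilde\rho_n(\mathsf d(x,y))$ for all $x\neq y$; (ii) for all $n>m$, $r\mapsto\tilde\rho_n(r)/\tilde\rho_m(r)$ is non-decreasing on $(0,+\infty)$; (iii) $\lim_{R\to+\infty}\lim_{n\to\infty}\int_R^{+\infty}S(r)\tilde\rho_n(r)\,\mathrm dr=1$. *)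

(* Defs.v *)
From HB Require Import structures.
From mathcomp Require Import all_boot all_order all_algebra.
From mathcomp Require Import all_classical all_reals all_analysis.
Set Implicit Arguments. Unset Strict Implicit. Unset Printing Implicit Defensive.
Import Order.TTheory GRing.Theory Num.Theory.
Import numFieldNormedType.Exports.
Local Open Scope classical_set_scope.
Local Open Scope ring_scope.

Section mms.
Context {R : realType} {disp : measure_display} {X : measurableType disp}.

Definition is_metric (dist : X -> X -> R) : Prop :=
  [/\ forall x y, 0 <= dist x y,
      forall x y, dist x y = 0 <-> x = y,
      forall x y, dist x y = dist y x &
      forall x y z, dist x z <= dist x y + dist y z].

Definition dball (dist : X -> X -> R) (x : X) (r : R) : set X :=
  [set y | dist x y < r].

Definition dopen (dist : X -> X -> R) (A : set X) : Prop :=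
  forall x, A x -> exists2 r : R, 0 < r & dball dist x r `<=` A.

Definition dcomplete (dist : X -> X -> R) : Prop :=
  forall u : nat -> X,
    (forall e : R, 0 < e -> exists N : nat, forall n m, (N <= n)%N -> (N <= m)%N ->
        dist (u n) (u m) < e) ->
    exists l : X, forall e : R, 0 < e -> exists N : nat, forall n, (N <= n)%N ->
        dist (u n) l < e.

Definition dseparable (dist : X -> X -> R) : Prop :=
  exists D : set X, countable D /\
    forall x (e : R), 0 < e -> exists2 y, D y & dist x y < e.

Definition metric_measure_space (dist : X -> X -> R)
  (m : {measure set X -> \bar R}) : Prop :=
  is_metric dist /\ dcomplete dist /\ dseparable dist /\
  (@measurable _ X) = <<s dopen dist >> /\
  (forall x, exists2 r : R, 0 < r & (m (dball dist x r) < +oo)%E) /\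
  (forall x (r : R), 0 < r -> (0 < m (dball dist x r))%E).

Definition is_AVR (dist : X -> X -> R) (m : {measure set X -> \bar R})
  (V : R -> R) (A : \bar R) : Prop :=
  (0 <= A)%E /\
  forall x0 : X, (m (dball dist x0 r) * ((V r)^-1)%:E)%E @[r --> +oo] --> A.

Definition nonlocal_energy (dist : X -> X -> R) (m : {measure set X -> \bar R})
  (p : R) (rho : R -> R) (u : X -> R) : \bar R :=
  (\int[m]_y \int[m]_(x in [set x | x <> y])
      ((`|u x - u y| `^ p) * rho (dist x y))%:E)%E.

Definition Lp_norm_pow (m : {measure set X -> \bar R}) (p : R) (u : X -> R)
  : \bar R := (\int[m]_x (`|u x| `^ p)%:E)%E.

Definition in_Lp (m : {measure set X -> \bar R}) (p : R) (u : X -> R) : Prop :=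
  measurable_fun setT u /\ (Lp_norm_pow m p u < +oo)%E.

End mms.

Section radial.
Context {R : realType}.

Definition admissible_V (V : R -> R) : Prop :=
  [/\ forall t, 0 <= t -> 0 <= V t,
      (forall s t, 0 <= s -> s < t -> V s < V t),
      (* C^1 on [0,+oo): derivable on (0,+oo) with continuous derivative,
         V right-continuous at 0 and V' having a finite right limit at 0 *)
      (forall t, 0 < t -> derivable V t 1) /\ {in `]0, +oo[, continuous (derive1 V)},
      V x @[x --> 0^'+] --> V 0 /\ cvg ((derive1 V) x @[x --> 0^'+]) &
      V t @[t --> +oo] --> +oo].

(** approximation of the identity of radial type associated to V
    (stated on the radial profiles rho_n = rt n) *)
Definition approx_identity_radial (V : R -> R) (rt : nat -> R -> R) : Prop :=
  (forall n, forall r s, 0 < r -> r < s -> rt n s < rt n r) /\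
  (forall n, (forall r, 0 < r -> derivable (rt n) r 1) /\
             {in `]0, +oo[, continuous (derive1 (rt n))}) /\
  (forall r, 0 < r -> rt n r @[n --> \oo] --> 0) /\
  (forall n, rt n r * V r @[r --> +oo] --> 0) /\
  (forall n m, (m < n)%N -> forall r s, 0 < r -> r <= s ->
      rt n r / rt m r <= rt n s / rt m s) /\
  (exists L : R -> \bar R,
        (\forall R0 \near +oo,
           (\int[lebesgue_measure]_(r in `[R0, +oo[) ((derive1 V) r * rt n r)%:E)%E
              @[n --> \oo] --> L R0) /\
        L R0 @[R0 --> +oo] --> 1%E).

End radial.

(* Main.v *)
(** Write [f := |u|^p].  For fixed [a > 0] the pairs at distance less than [a]
    contribute at most [rt n a / rt n0 a] times the energy of index [n0], by the
    monotonicity of the ratios, hence nothing in the limit.  Slicing the profile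
    into superlevel sets, which are intervals [[a, s)], turns the comparison of
    [m (B_s x)] with [AVR * V s] into one of [int_{d(x,y) >= a} rt n (d(x,y)) dm(y)]
    with [AVR * int_a^oo V' * rt n]; so the former tends to [AVR] for each [x], with a
    uniform bound, and dominated convergence and Tonelli give
    [int int_{d >= a} (f x + f y) * rt n --> 2 * AVR * int f].  Finally
    [|u x - u y|^p] equals [f x + f y] up to a factor close to 1 and a multiple of
    [min (f x) (f y)].  If [a > 2 M] this minimum is at most [w x + w y], with [w] the
    restriction of [f] to the complement of a ball of radius [M], and [int w] is small
    for large [M]. *)
Require Import Defs.
From HB Require Import structures.
From mathcomp Require Import all_boot all_order all_algebra.
From mathcomp Require Import all_classical all_reals all_analysis.
From mathcomp Require Import measurable_realfun ring lra.
Set Implicit Arguments. Unset Strict Implicit. Unset Printing Implicit Defensive.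
Import Order.TTheory GRing.Theory Num.Theory.
Import numFieldNormedType.Exports.
Local Open Scope classical_set_scope.
Local Open Scope ring_scope.

(** * Convergence criteria and a pointwise inequality *)

(** The two bounds already force [u t] to be finite, so one order condition replaces both halves of
    [fine_cvgP]. Limits in the extended reals thus become linear inequalities between reals. *)
Lemma cvge_within (R : realType) (T : Type) (F : set_system T) {FF : Filter F}
    (u : T -> \bar R) (l : R) :
  u t @[t --> F] --> l%:E <->
  forall e, 0 < e -> \forall t \near F, ((l - e)%:E <= u t <= (l + e)%:E)%E.
Proof.
split=> [cu e e0|H].
  have [fu cfu] := (fine_cvgP u l).1 cu.
  have /cvgrPdist_le/(_ e e0) H := cfu.
  near=> n.
  have fn : u n \is a fin_num by near: n; exact: fu.
  have : `|l - fine (u n)| <= e by near: n; exact: H.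
  by rewrite -(fineK fn) /= !lee_fin ler_distlC.
apply/fine_cvgP; split.
  have := H 1 ltr01; apply: filterS => n /andP[a b].
  by case: (u n) a b.
apply/cvgrPdist_le => e e0; have := H e e0; apply: filterS => n /andP[a b] /=.
case: (u n) a b => [r| |]//=; rewrite !lee_fin => a b.
by rewrite ler_distlC; apply/andP; split; lra.
Unshelve. all: by end_near. Qed.

(** Adapted to bounds that lose a factor [c] arbitrarily close to 1, as the pointwise inequality
    below does. The second inequality keeps [u n] on the larger side, so no division of extended
    reals occurs. *)
Lemma cvge_multiplicative_squeeze (R : realType) (u : nat -> \bar R) (l : R) :
  0 <= l ->
  (forall c e : R, 1 < c -> 0 < e -> \forall n \near \oo,
    (u n <= (c * l + e)%:E)%E /\ (l%:E <= c%:E * u n + e%:E)%E) ->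
  u n @[n --> \oo] --> l%:E.
Proof.
move=> l0 H; apply/cvge_within => e e0.
(* With [c = 1 + d] the multiplicative error is at most [d * l <= e / 2], and the additive one is
   [e / 2]. Dividing by [l + 1] rather than [l] covers [l = 0]. *)
pose d := e / 2 / (l + 1).
have l1 : 0 < l + 1 by lra.
have d0 : 0 < d by rewrite !divr_gt0.
have de : d * (l + 1) = e / 2 by rewrite /d divfK// gt_eqF.
have c1 : 1 < 1 + d by lra.
have e2 : 0 < e / 2 by lra.
have := H _ _ c1 e2; apply: filterS => n [].
case: (u n) => [r| |]//=; last by rewrite gt0_muleNy// lte_fin; lra.
rewrite -EFinM -EFinD !lee_fin => a b.
apply/andP; split; last by nra.
have [lr|rl] := leP l r; first by lra.
have : d * r <= d * l by rewrite ler_pM2l// ltW.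
nra.
Qed.

(** Let [z <= x + y]. If [y <= d * x], then [z <= (1 + d) * x], and the factor becomes
    [(1 + d) ^ p = c]. Otherwise [x] is at most [y / d], so [z] is bounded by a multiple of [y]
    alone. Taking for [y] the smaller of [|a|] and [|b|] puts the whole loss on the minimum. *)
Lemma powR_diff_bounds (R : realType) (p c : R) : 0 < p -> 1 < c ->
  exists2 C : R, 0 <= C & forall a b : R,
  `|a - b| `^ p <= c * (`|a| `^ p + `|b| `^ p)
                   + C * Num.min (`|a| `^ p) (`|b| `^ p) /\
  `|a| `^ p + `|b| `^ p <= c * `|a - b| `^ p
                   + C * Num.min (`|a| `^ p) (`|b| `^ p).
Proof.
move=> p0 c1.
pose d := c `^ p^-1 - 1.
have pV : 0 < p^-1 by rewrite invr_gt0.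
have d0 : 0 < d.
  rewrite /d subr_gt0; have : 1 `^ p^-1 < c `^ p^-1.
    by apply: gt0_ltr_powR; rewrite ?nnegrE//; lra.
  by rewrite powR1.
have dp : (1 + d) `^ p = c.
  by rewrite /d addrC subrK -powRrM mulVf ?gt_eqF// powRr1//; lra.
have pm (x y : R) : 0 <= x -> x <= y -> x `^ p <= y `^ p.
  by move=> x0 xy; apply: ge0_ler_powR; rewrite ?nnegrE//; [lra|exact: le_trans xy].
pose K := (1 + d^-1) `^ p.
have K0 : 0 <= K by exact: powR_ge0.
have key (x y z : R) : 0 <= x -> 0 <= y -> 0 <= z -> z <= x + y ->
    z `^ p <= c * x `^ p + K * y `^ p.
  move=> x0 y0 z0 zxy.
  have [yx|xy] := leP y (d * x).
    have /(pm _ _ z0) : z <= (1 + d) * x by lra.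
    rewrite powRM//; last by lra.
    rewrite dp => /le_trans; apply; rewrite lerDl mulr_ge0// powR_ge0//.
  have /(pm _ _ z0) : z <= (1 + d^-1) * y.
    have : x <= d^-1 * y by rewrite mulrC ler_pdivlMr//; lra.
    lra.
  rewrite powRM//; last by rewrite addr_ge0// invr_ge0; lra.
  by move/le_trans; apply; rewrite lerDr mulr_ge0// ?powR_ge0//; lra.
(* The extra 1 pays for the summand [|b| ^ p] on the left of the second inequality, where [key]
   bounds only [|a| ^ p]. *)
exists (K + 1); first by lra.
wlog ab : / forall a b : R, `|b| <= `|a| ->
   `|a - b| `^ p <= c * (`|a| `^ p + `|b| `^ p) + (K + 1) * `|b| `^ p /\
  `|a| `^ p + `|b| `^ p <= c * `|a - b| `^ p + (K + 1) * `|b| `^ p.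
  apply => a b ba.
  have a0 : 0 <= `|a| `^ p := powR_ge0 _ _.
  have b0 : 0 <= `|b| `^ p := powR_ge0 _ _.
  split.
    have := key `|a| `|b| `|a - b| (normr_ge0 _) (normr_ge0 _) (normr_ge0 _) (ler_normB _ _).
    nra.
  have h : `|a| <= `|a - b| + `|b|.
    by rewrite -{1}(subrK b a) ler_normD.
  have := key `|a - b| `|b| `|a| (normr_ge0 _) (normr_ge0 _) (normr_ge0 _) h.
  nra.
move=> a b.
have [ba|/ltW ba] := leP `|b| `|a|.
  by rewrite min_r; [exact: ab|exact: pm].
have := ab _ _ ba; rewrite min_l; last exact: pm.
by rewrite (distrC a b) (addrC (`|a| `^ p) (`|b| `^ p)).
Qed.

(** * Superlevel sets of radial profiles and the layer-cake formula *)

(** Cutting at some [a > 0] keeps away from a possible singularity at 0, and the extension by zero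
    gives a function on the whole line that can be composed with a distance. *)
Definition tail_profile {R : realType} (rho : R -> R) (a : R) : R -> R :=
  fun r => if a <= r then rho r else 0.

Section radial_profile.
Context {R : realType} (V rho : R -> R).
Hypothesis Vy : V t @[t --> +oo] --> +oo.
Hypothesis rho_decr : forall r s : R, 0 < r -> r < s -> rho s < rho r.
Hypothesis rho_derivable : forall r : R, 0 < r -> derivable rho r 1.
Hypothesis rhoV0 : rho r * V r @[r --> +oo] --> 0.

(** Eventually [V r >= 1], so [|rho r|] is dominated by [|rho r * V r|]. *)
Lemma profile_cvg0 : rho r @[r --> +oo] --> 0.
Proof.
apply/cvgrPdist_lt => e e0.
have /cvgrPdist_lt/(_ e e0) H := rhoV0.
have /cvgryPge/(_ 1) K := Vy.
near=> r.
have h1 : `|0 - rho r * V r| < e by near: r; exact: H.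
have h2 : 1 <= V r by near: r; exact: K.
move: h1; rewrite !sub0r !normrN normrM => h1.
apply: le_lt_trans h1; rewrite ler_peMr//.
by rewrite ger0_norm//; lra.
Unshelve. all: by end_near. Qed.

(** A nonpositive value at [r] would make [rho (r + 1)] negative, and by monotonicity the profile
    would stay below that value, against its limit 0. *)
Lemma profile_gt0 r : 0 < r -> 0 < rho r.
Proof.
move=> r0; rewrite ltNge; apply/negP => rr.
have r1 : rho (r + 1) < rho r by apply: rho_decr; lra.
have e0 : 0 < - rho (r + 1) by lra.
have /cvgrPdist_lt/(_ _ e0) H := profile_cvg0.
near (pinfty_nbhs R) => s.
have h1 : `|0 - rho s| < - rho (r + 1) by near: s; exact: H.
have h2 : r + 1 < s by near: s; apply: nbhs_pinfty_gt; rewrite num_real.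
have : rho s < rho (r + 1) by apply: rho_decr => //; lra.
move: h1; rewrite sub0r normrN ltr_norml; lra.
Unshelve. all: by end_near. Qed.

Lemma profile_nonincr r s : 0 < r -> r <= s -> rho s <= rho r.
Proof.
by move=> r0; rewrite le_eqVlt => /orP[/eqP->//|/(rho_decr r0)/ltW].
Qed.

(** The profile exceeds [t] at [a] and is below [t] far away, so it takes the value [t] at some [s];
    strict monotonicity then decides on which side of [s] each radius lies. *)
Lemma profile_superlevel a t : 0 < a -> 0 < t < rho a ->
  exists2 s, a < s & forall r, a <= r -> (t < rho r) = (r < s).
Proof.
move=> a0 /andP[t0 ta].
have /cvgrPdist_lt/(_ _ t0) H := profile_cvg0.
near (pinfty_nbhs R) => T.
have h1 : `|0 - rho T| < t by near: T; exact: H.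
have h2 : a < T by near: T; apply: nbhs_pinfty_gt; rewrite num_real.
have rT : rho T < t by move: h1; rewrite sub0r normrN ltr_norml; lra.
have [] := @IVT R rho a T t (ltW h2).
- apply: derivable_within_continuous => x; rewrite in_itv/= => /andP[ax _].
  by apply: rho_derivable; lra.
- by rewrite min_r ?max_l; lra.
move=> s; rewrite in_itv/= => /andP[a_s sT] st.
have a_s' : a < s.
  by rewrite lt_neqAle a_s andbT; apply: contraTneq ta => ->; rewrite st ltxx.
exists s => // r ar; rewrite -st.
have [rs|sr] := ltP r s; first by apply: rho_decr => //; lra.
apply/negbTE; rewrite -leNgt; apply: profile_nonincr => //; lra.
Unshelve. all: by end_near. Qed.

Lemma tail_profile_ge0 a r : 0 < a -> 0 <= tail_profile rho a r.
Proof.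
by move=> a0; rewrite /tail_profile; case: ifPn => // ar; apply/ltW/profile_gt0; lra.
Qed.

Lemma measurable_profile : measurable_fun (`]0, +oo[ : set R) rho.
Proof.
apply: subspace_continuous_measurable_fun => //.
apply: derivable_within_continuous => x; rewrite in_itv/= andbT.
exact: rho_derivable.
Qed.

Lemma measurable_tail_profile a : 0 < a ->
  measurable_fun setT (tail_profile rho a).
Proof.
move=> a0; apply: measurable_fun_if => //.
- exact: measurable_fun_ler.
- apply: measurable_funS measurable_profile => //.
  by move=> x [_] /= ax; rewrite in_itv/= andbT; lra.
Qed.

End radial_profile.

Lemma measurable_layer {d} {Y : measurableType d} {R : realType} (h Q : Y -> R) :
  measurable_fun setT h -> measurable_fun setT Q ->
  measurable_fun setT (fun z : Y * measurableTypeR R =>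
    (if 0 < z.2 < Q z.1 then h z.1 else 0)%:E).
Proof.
move=> mh mQ; apply/measurable_EFinP; apply: measurable_fun_ifT => //.
  apply: measurable_and; apply: measurable_fun_ltr => //.
  exact: measurableT_comp.
exact: measurableT_comp.
Qed.

Lemma measurable_layer_integral {d} {Y : measurableType d} {R : realType}
    (mu : {sigma_finite_measure set Y -> \bar R}) (h Q : Y -> R) :
  measurable_fun setT h -> measurable_fun setT Q -> (forall y, 0 <= h y) ->
  measurable_fun setT (fun t : measurableTypeR R =>
    \int[mu]_y (if 0 < t < Q y then h y else 0)%:E)%E.
Proof.
move=> mh mQ h0.
have k0 (z : Y * measurableTypeR R) :
    (0 <= (if (0 : R) < z.2 < Q z.1 then h z.1 else 0)%:E)%E.
  by rewrite lee_fin; case: ifP.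
exact: (measurable_fun_fubini_tonelli_G (m1 := mu) _ (measurable_layer mh mQ) k0).
Qed.

(** The number [Q y] is the length of []0, Q y[], and Tonelli exchanges this length with the
    integral in [y]. The weight [h] lets one formula serve both the measure on the space, with
    [h = 1], and the density [V'] on the half-line. *)
Lemma layer_cake {d} {Y : measurableType d} {R : realType}
    (mu : {sigma_finite_measure set Y -> \bar R}) (h Q : Y -> R) :
  measurable_fun setT h -> measurable_fun setT Q ->
  (forall y, 0 <= h y) -> (forall y, 0 <= Q y) ->
  (\int[mu]_y (h y * Q y)%:E =
   \int[lebesgue_measure]_t \int[mu]_y (if 0 < t < Q y then h y else 0)%:E)%E.
Proof.
move=> mh mQ h0 Q0.
pose k (z : Y * measurableTypeR R) : \bar R :=
  (if 0 < z.2 < Q z.1 then h z.1 else 0)%:E.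
have mk : measurable_fun setT k by exact: measurable_layer.
have k0 z : (0 <= k z)%E by rewrite lee_fin; case: ifP.
rewrite -(@fubini_tonelli _ _ _ _ _ mu lebesgue_measure k)//.
apply: eq_integral => y _.
transitivity (\int[lebesgue_measure]_(t in (setT : set (measurableTypeR R))) ((h y)%:E * (\1_(`]0, Q y[ : set (measurableTypeR R)) t)%:E))%E.
  rewrite ge0_integralZl//; first last.
  - by rewrite lee_fin.
  - by apply/measurable_EFinP; exact: measurable_indic.
  rewrite integral_indic//= setIT lebesgue_measure_itv/= lte_fin.
  have := Q0 y; rewrite le_eqVlt => /orP[/eqP<-|Qy]; first by rewrite ltxx mule0 mulr0.
  by rewrite Qy sube0 EFinM.
apply: eq_integral => t _; rewrite /k /= indicE -EFinM.
case: ifPn => tQ; first by rewrite mem_set ?mulr1//= in_itv.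
by rewrite memNset ?mulr0//= in_itv/=; exact/negP.
Qed.

(** * Comparison of integrals of a profile from comparison of annuli *)

Section volume_profile.
Context {R : realType} (V : R -> R).
Hypothesis V_incr : forall s t : R, 0 <= s -> s < t -> V s < V t.
Hypothesis V_derivable : forall t : R, 0 < t -> derivable V t 1.
Hypothesis dV_continuous : {in `]0, +oo[, continuous (derive1 V)}.

Lemma volume_derive_ge0 r : 0 < r -> 0 <= derive1 V r.
Proof.
move=> r0; apply: (@incr_derive1_ge0_itvy R V false 0).
- by move=> x; rewrite inE/= in_itv/= andbT; exact: V_derivable.
- move=> x y; rewrite !in_itv/= !andbT => x0 _; apply: V_incr; exact: ltW.
- by rewrite in_itv/= andbT.
Qed.

Lemma volume_continuous r : 0 < r -> {for r, continuous V}.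
Proof.
by move=> r0; exact/differentiable_continuous/derivable1_diffP/V_derivable.
Qed.

Lemma measurable_volume_derive : measurable_fun (`]0, +oo[ : set R) (derive1 V).
Proof.
apply: subspace_continuous_measurable_fun => //.
by apply: continuous_in_subspaceT => x; rewrite inE => /dV_continuous.
Qed.

Lemma integral_volume_derive a s : 0 < a -> a < s ->
  (\int[lebesgue_measure]_(r in `[a, s]) (derive1 V r)%:E = (V s - V a)%:E)%E.
Proof.
move=> a0 a_s; rewrite EFinB; apply: continuous_FTC2 => //.
- apply: continuous_in_subspaceT => x; rewrite inE/= in_itv/= => /andP[ax _].
  by apply: dV_continuous; rewrite in_itv/= andbT; lra.
- split.
  + by move=> x; rewrite in_itv/= => /andP[ax _]; apply: V_derivable; lra.
  + by apply: cvg_at_right_filter; exact: volume_continuous.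
  + by apply: cvg_at_left_filter; apply: volume_continuous; lra.
Qed.

Lemma tail_volume_derive_ge0 a r : 0 < a -> 0 <= tail_profile (derive1 V) a r.
Proof.
move=> a0; rewrite /tail_profile; case: ifPn => // ar.
by apply: volume_derive_ge0; lra.
Qed.

Lemma measurable_tail_volume_derive a : 0 < a ->
  measurable_fun setT (tail_profile (derive1 V) a).
Proof.
move=> a0; apply: measurable_fun_if => //.
- exact: measurable_fun_ler.
- apply: measurable_funS measurable_volume_derive => //.
  by move=> x [_] /= ax; rewrite in_itv/= andbT; lra.
Qed.

Context (rho : R -> R).
Hypothesis Vy : V t @[t --> +oo] --> +oo.
Hypothesis rho_decr : forall r s : R, 0 < r -> r < s -> rho s < rho r.
Hypothesis rho_derivable : forall r : R, 0 < r -> derivable rho r 1.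
Hypothesis rhoV0 : rho r * V r @[r --> +oo] --> 0.

Let rho_gt0 := profile_gt0 Vy rho_decr rhoV0.
Let mtail a (a0 : 0 < a) := measurable_tail_profile rho_derivable a0.
Let tail0 a r (a0 : 0 < a) := tail_profile_ge0 Vy rho_decr rhoV0 r a0.
Let level := profile_superlevel Vy rho_decr rho_derivable rhoV0.

(** The cut profile vanishes below [a] and is at most [rho a] beyond it, so only levels in []0, rho
    a[] have a nonempty layer. *)
Lemma tail_profile_layers a t : 0 < a ->
  (0 < t < rho a /\ exists2 s, a < s &
     forall r, (0 < t < tail_profile rho a r) = (a <= r < s)) \/
  (~ (0 < t < rho a) /\ forall r, (0 < t < tail_profile rho a r) = false).
Proof.
move=> a0; have [ta|ta] := boolP (0 < t < rho a); [left|right].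
  split => //; have [s a_s sP] := level a0 ta; exists s => // r.
  rewrite /tail_profile; case: ifPn => [ar|_] /=; first by rewrite -sP//; case/andP: ta => ->.
  by apply/negbTE/negP => /andP[]; lra.
split; first exact/negP.
move=> r; rewrite /tail_profile; case: ifPn => [ar|_].
  apply: contraNF ta => /andP[-> /lt_le_trans]; apply.
  exact: profile_nonincr.
by apply/negbTE/negP => /andP[]; lra.
Qed.

(** The integral that appears in the normalization condition on the mollifiers. *)
Definition tail_mass a : \bar R :=
  (\int[lebesgue_measure]_(r in `[a, +oo[) (derive1 V r * rho r)%:E)%E.

Lemma tail_massE a : (tail_mass a =
  \int[lebesgue_measure]_(r in (setT : set (measurableTypeR R)))
    (tail_profile (derive1 V) a r * tail_profile rho a r)%:E)%E.
Proof.
rewrite /tail_mass integral_mkcond; apply: eq_integral => r _.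
rewrite patchE /tail_profile; case: ifPn.
  by rewrite inE/= in_itv/= andbT => ->.
rewrite notin_setE/= in_itv/= andbT => /negP/negbTE ->.
by rewrite mulr0.
Qed.

Context {d} {Y : measurableType d} (mu : {sigma_finite_measure set Y -> \bar R}).
Context (g : Y -> R).
Hypothesis mg : measurable_fun setT g.

Let annulus a s := [set y | a <= g y < s].

Let measurable_annulus a s : measurable (annulus a s).
Proof.
have := mg measurableT (measurable_itv `[a, s[).
rewrite setTI; congr measurable; apply/seteqP; split => y /=;
by rewrite in_itv.
Qed.

(** The layers at level [t] of the two integrals to be compared: one will be the measure of an
    annulus, the other the increment of [V] over the same radii. *)
Let GF a t := (\int[mu]_y (if 0 < t < tail_profile rho a (g y) then 1 else 0)%:E)%E.
Let GI a t := (\int[lebesgue_measure]_(r in (setT : set (measurableTypeR R)))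
  (if 0 < t < tail_profile rho a r then tail_profile (derive1 V) a r else 0)%:E)%E.

Let mQ a : 0 < a -> measurable_fun setT (fun y => tail_profile rho a (g y)).
Proof. by move=> a0; apply: measurableT_comp mg; exact: mtail. Qed.

Let FE a : 0 < a -> (\int[mu]_y (tail_profile rho a (g y))%:E =
  \int[lebesgue_measure]_t GF a t)%E.
Proof.
move=> a0; rewrite /GF -layer_cake//; last 2 first.
- exact: mQ.
- by move=> y; exact: tail0.
by apply: eq_integral => y _; rewrite mul1r.
Qed.

Let IE a : 0 < a -> (tail_mass a = \int[lebesgue_measure]_t GI a t)%E.
Proof.
move=> a0; rewrite tail_massE layer_cake//.
- exact: measurable_tail_volume_derive.
- exact: mtail.
- by move=> y; exact: tail_volume_derive_ge0.
- by move=> y; exact: tail0.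
Qed.

Let mGF a : 0 < a -> measurable_fun (setT : set (measurableTypeR R)) (GF a).
Proof. by move=> a0; apply: measurable_layer_integral => //; exact: mQ. Qed.

Let mGI a : 0 < a -> measurable_fun (setT : set (measurableTypeR R)) (GI a).
Proof.
move=> a0; apply: measurable_layer_integral => //.
- exact: measurable_tail_volume_derive.
- exact: mtail.
- by move=> y; exact: tail_volume_derive_ge0.
Qed.

Let GF0 a t : (0 <= GF a t)%E.
Proof. by apply: integral_ge0 => y _; rewrite lee_fin; case: ifP. Qed.

Let GI0 a t : 0 < a -> (0 <= GI a t)%E.
Proof.
move=> a0; apply: integral_ge0 => y _; rewrite lee_fin; case: ifP => // _.
exact: tail_volume_derive_ge0.
Qed.

Let layers a t : 0 < a ->
  (0 < t < rho a /\ exists2 s, a < s &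
     GF a t = mu (annulus a s) /\ GI a t = (V s - V a)%:E) \/
  (~ (0 < t < rho a) /\ GF a t = 0%E /\ GI a t = 0%E).
Proof.
move=> a0; have [[ta [s a_s sP]]|[ta tP]] := tail_profile_layers t a0; [left|right].
  split => //; exists s => //; split.
    transitivity (\int[mu]_y (\1_(annulus a s) y)%:E)%E; last first.
      by rewrite integral_indic// setIT.
    apply: eq_integral => y _.
    rewrite sP indicE; case: ifPn => h; first by rewrite mem_set.
    by rewrite memNset//; exact/negP.
  rewrite -integral_volume_derive// -integral_itv_bndo_bndc; last first.
    apply/measurable_EFinP; apply: measurable_funS measurable_volume_derive => //.
    by move=> x /=; rewrite !in_itv/= andbT => /andP[ax _]; lra.
  rewrite /GI [RHS]integral_mkcond; apply: eq_integral => r _.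
  rewrite sP patchE; case: ifPn => h; last by rewrite memNset//= in_itv/=; exact/negP.
  by rewrite mem_set ?in_itv//= /tail_profile; case/andP: h => ->.
split => //; split; apply: integral0_eq => r _; by rewrite tP.
Qed.

(** A constant error [b] on each nonempty layer costs [b * rho a] in total, since the levels
    involved have length [rho a]. *)
Let cst_layer (b a : R) : 0 <= b -> 0 < a ->
  (\int[lebesgue_measure]_(t in (setT : set (measurableTypeR R)))
    (b%:E * (\1_(`]0, rho a[ : set (measurableTypeR R)) t)%:E) = (b * rho a)%:E)%E.
Proof.
move=> b0 a0; rewrite ge0_integralZl//; last first.
  by apply/measurable_EFinP; exact: measurable_indic.
rewrite integral_indic//= setIT lebesgue_measure_itv/= lte_fin rho_gt0//.
by rewrite sube0 EFinM.
Qed.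

(** Both integrals are sums over levels [t] of quantities attached to the same annulus, so an
    inequality valid for all annuli integrates in [t]. Nonnegative coefficients on both sides avoid
    subtraction of extended reals and cover upper and lower bounds at once. *)
Lemma tail_integral_comparison (c1 c2 e1 e2 b a : R) :
  0 <= c1 -> 0 <= c2 -> 0 <= e1 -> 0 <= e2 -> 0 <= b -> 0 < a ->
  (forall s, a < s -> (c1%:E * mu (annulus a s) + (c2 * (V s - V a))%:E <=
     e1%:E * mu (annulus a s) + (e2 * (V s - V a))%:E + b%:E)%E) ->
  (c1%:E * \int[mu]_y (tail_profile rho a (g y))%:E + c2%:E * tail_mass a <=
   e1%:E * \int[mu]_y (tail_profile rho a (g y))%:E + e2%:E * tail_mass a +
     (b * rho a)%:E)%E.
Proof.
move=> c10 c20 e10 e20 b0 a0 H.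
have lin (x y : R) : 0 <= x -> 0 <= y ->
    (x%:E * \int[mu]_y (tail_profile rho a (g y))%:E + y%:E * tail_mass a =
     \int[lebesgue_measure]_t (x%:E * GF a t + y%:E * GI a t))%E.
  move=> x0 y0; rewrite FE// IE//.
  rewrite -ge0_integralZl//; last exact: mGF.
  rewrite -ge0_integralZl//; last 2 first.
  - exact: mGI.
  - by move=> t _; exact: GI0.
  rewrite -ge0_integralD//.
  - by move=> t _; rewrite mule_ge0.
  - by apply: measurable_funeM; exact: mGF.
  - by move=> t _; rewrite mule_ge0// GI0.
  - by apply: measurable_funeM; exact: mGI.
have m2 (x y : R) : measurable_fun (setT : set (measurableTypeR R))
    (fun t => x%:E * GF a t + y%:E * GI a t)%E.
  by apply: emeasurable_funD; apply: measurable_funeM; [exact: mGF|exact: mGI].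
have p2 (x y : R) t : 0 <= x -> 0 <= y -> (0 <= x%:E * GF a t + y%:E * GI a t)%E.
  by move=> x0 y0; rewrite adde_ge0// mule_ge0// GI0.
have mb : measurable_fun (setT : set (measurableTypeR R))
    (fun t => b%:E * (\1_(`]0, rho a[ : set (measurableTypeR R)) t)%:E)%E.
  by apply: measurable_funeM; apply/measurable_EFinP; exact: measurable_indic.
rewrite !lin// -cst_layer// -ge0_integralD//; last 2 first.
- by move=> t _; exact: p2.
- by move=> t _; rewrite mule_ge0// lee_fin.
apply: ge0_le_integral => //.
- by move=> t _; exact: p2.
- by apply: emeasurable_funD.
move=> t _; have [[ta [s a_s [-> ->]]]|[ta [-> ->]]] := layers t a0.
  rewrite indicE mem_set/=; last by rewrite in_itv.
  by rewrite mule1 -!EFinM; exact: H.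
by rewrite !mule0 !add0e mule_ge0// lee_fin.
Qed.

End volume_profile.

(** * Measurability of the distance *)

Section metric_measurability.
Context {R : realType} {disp : measure_display} {X : measurableType disp}.
Variable dist : X -> X -> R.
Hypothesis dist_metric : is_metric dist.
Hypothesis dist_separable : dseparable dist.
Hypothesis dist_borel : (@measurable _ X) = <<s dopen dist >>.

Lemma measurable_dball x r : measurable (dball dist x r).
Proof.
rewrite dist_borel; apply: sub_sigma_algebra => y /= xy.
case: dist_metric => _ _ _ tri.
exists (r - dist x y); first by rewrite subr_gt0.
move=> z /= yz; have := tri x y z; rewrite /dball/= in xy yz *; lra.
Qed.

(** The product sigma-algebra is generated by rectangles, so [dist < r] is written as a countable
    union of products of balls centred at points of the dense set, with rational [s] and radii [s]
    and [r - s]. *)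
Lemma measurable_dist : measurable_fun setT (fun z : X * X => dist z.1 z.2).
Proof.
case: dist_metric => d0 _ sym tri; case: dist_separable => D [cD dD].
apply: (measurability _ (RGenInftyO.measurableE R)) => // _ [_ [r ->] <-].
rewrite setTI.
(* The injection [f] numbers the dense set; [A n s] is empty when [n] numbers no point of it. *)
have /countable_injP[f finj] := cD.
pose A n s : set (X * X) := [set z | exists q,
  [/\ D q, f q = n, dist q z.1 < s & dist q z.2 < r - s]].
have mA n s : measurable (A n s).
  have [[q [Dq fq]]|nq] := pselect (exists q, D q /\ f q = n).
    have -> : A n s = dball dist q s `*` dball dist q (r - s).
      apply/seteqP; split => [z [q' [Dq' fq' h1 h2]]|z [h1 h2]]; last by exists q.
      have -> : q = q' by apply: finj; rewrite ?inE// fq fq'.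
      by split.
    by apply: measurableX; exact: measurable_dball.
  have -> : A n s = set0; last exact: measurable0.
  by apply/seteqP; split => // z [q [Dq fq _ _]]; apply: nq; exists q.
rewrite (_ : _ @^-1` _ = \bigcup_n \bigcup_s A n (ratr s)).
  apply: bigcupT_measurable => n; exact: bigcupT_measurable_rat.
apply/seteqP; split => [z /=|z [n _ [s _ [q [_ _ h1 h2]]]] /=]; last first.
  by rewrite in_itv/=; have := tri z.1 q z.2; rewrite (sym z.1 q); lra.
rewrite in_itv/= => zr.
(* For [q] within [e] of [z.1] and [s < e], the distance from [q] to [z.2] is below [r - 3 * e],
   hence below [r - s]. *)
pose e := (r - dist z.1 z.2) / 4.
have e0 : 0 < e by rewrite /e; lra.
have [q Dq qe] := dD z.1 e e0.
have [s] := rat_in_itvoo qe; rewrite in_itv/= => /andP[h1 h2].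
exists (f q) => //; exists s => //; exists q; split => //.
  by rewrite sym.
have := tri q z.1 z.2; rewrite (sym q z.1); rewrite /e in qe h2; lra.
Qed.

End metric_measurability.

(** * Averages of the kernels over the far region *)

Section radial_averages.
Context {R : realType} {disp : measure_display} {X : measurableType disp}.
Variables (dist : X -> X -> R) (m : {sigma_finite_measure set X -> \bar R}).
Hypothesis mball : forall x r, measurable (dball dist x r).
Hypothesis mdist : measurable_fun setT (fun z : X * X => dist z.1 z.2).
Hypothesis ball_fin : forall x r, (m (dball dist x r) < +oo)%E.

Variables (V : R -> R) (rt : nat -> R -> R).
Hypothesis V_ge0 : forall t : R, 0 <= t -> 0 <= V t.
Hypothesis V_incr : forall s t : R, 0 <= s -> s < t -> V s < V t.
Hypothesis V_derivable : forall t : R, 0 < t -> derivable V t 1.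
Hypothesis dV_continuous : {in `]0, +oo[, continuous (derive1 V)}.
Hypothesis Vy : V t @[t --> +oo] --> +oo.
Hypothesis rt_decr : forall n, forall r s : R, 0 < r -> r < s -> rt n s < rt n r.
Hypothesis rt_derivable : forall n (r : R), 0 < r -> derivable (rt n) r 1.
Hypothesis rtV0 : forall n, rt n r * V r @[r --> +oo] --> 0.
Hypothesis rt0 : forall r, 0 < r -> rt n r @[n --> \oo] --> 0.
Variable a : R.
Hypothesis a0 : 0 < a.
Hypothesis mass1 : tail_mass V (rt n) a @[n --> \oo] --> 1%E.

Let V_gt0 t : 0 < t -> 0 < V t.
Proof. by move=> t0; apply: le_lt_trans (V_incr _ t0) => //; exact: V_ge0. Qed.

Let V_mono s t : 0 <= s -> s <= t -> V s <= V t.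
Proof. by move=> s0; rewrite le_eqVlt => /orP[/eqP->//|/(V_incr s0)/ltW]. Qed.

Let mdist1 x : measurable_fun setT (dist x).
Proof. exact: (measurableT_comp mdist (measurable_pair1 x)). Qed.

Let annulus x s := [set y | a <= dist x y < s].

Let mannulus x s : measurable (annulus x s).
Proof.
have -> : annulus x s = dball dist x s `\` dball dist x a.
  apply/seteqP; split => y; rewrite /annulus/dball/= leNgt.
    by move=> /andP[/negP].
  by move=> [-> /negP ->].
exact: measurableD.
Qed.

Definition tail_average n x : \bar R :=
  (\int[m]_y (tail_profile (rt n) a (dist x y))%:E)%E.

Let annulus_le x s : (m (annulus x s) <= m (dball dist x s))%E.
Proof. by apply: le_measure; rewrite ?inE// => y /andP[]. Qed.

Let comparison n x := tail_integral_comparison V_incr V_derivable dV_continuous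
  Vy (@rt_decr n) (@rt_derivable n) (@rtV0 n) (mu := m) (@mdist1 x).

(** On annuli, [k * V s = k * (V s - V a) + k * V a], so the comparison has error constant
    [k * V a]. Eventually the tail mass is at most 2 and the error [k * V a * rt n a] at most 1;
    neither threshold depends on [x]. *)
Lemma tail_average_bound (k R0 : R) : 0 <= k -> R0 <= a ->
  (forall r, R0 <= r -> forall x, (m (dball dist x r) <= (k * V r)%:E)%E) ->
  \forall n \near \oo, forall x, (tail_average n x <= (k * 2 + 1)%:E)%E.
Proof.
move=> k0 R0a mk.
have b0 : 0 <= k * V a by rewrite mulr_ge0// V_ge0// ltW.
have I1 := (cvge_within _ _).1 mass1 _ ltr01.
have r1 : \forall n \near \oo, k * V a * rt n a <= 1.
  have : k * V a * rt n a @[n --> \oo] --> k * V a * 0.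
    by apply: cvgMr; exact: rt0.
  rewrite mulr0 => /cvgrPdist_le/(_ _ ltr01); apply: filterS => n.
  by rewrite sub0r normrN ler_norml => /andP[].
near=> n => x.
have : (1%:E * tail_average n x + 0%:E * tail_mass V (rt n) a <=
   0%:E * tail_average n x + k%:E * tail_mass V (rt n) a + (k * V a * rt n a)%:E)%E.
  apply: (@comparison n x 1 0 0 k (k * V a) a) => //.
  move=> s a_s; rewrite mul1e mul0r adde0 mul0e add0e.
  apply: le_trans (annulus_le x s) _.
  have R0s : R0 <= s by lra.
  apply: le_trans (mk _ R0s x) _.
  by rewrite -EFinD lee_fin; lra.
rewrite mul1e !mul0e adde0 add0e => /le_trans; apply.
have rn : k * V a * rt n a <= 1 by near: n.
have /andP[_ h] : ((1 - 1)%:E <= tail_mass V (rt n) a <= (1 + 1)%:E)%E.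
  by near: n; exact: I1.
rewrite EFinD leeD// EFinM lee_wpmul2l//.
Unshelve. all: by end_near. Qed.

(** Up to an additive constant, the annulus from [a] to [s] has measure between
    [(A - h) * (V s - V a)] and [(A + h) * (V s - V a)]. The comparison multiplies that constant by
    [rt n a], which tends to 0. *)
Lemma cvg_tail_average x (A : R) : 0 <= A ->
  (m (dball dist x r) * ((V r)^-1)%:E)%E @[r --> +oo] --> A%:E ->
  tail_average n x @[n --> \oo] --> A%:E.
Proof.
move=> A0 /cvge_within cA; apply/cvge_within => e e0.
(* The final error is at most [h * (A + 2 + h)], which [h <= 1] bounds by [h * (A + 3) <= e]. *)
pose h := Num.min 1 (e / (A + 3)).
have A3 : 0 < A + 3 by lra.
have h0 : 0 < h by rewrite lt_min ltr01 divr_gt0.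
have h1 : h <= 1 by rewrite ge_min lexx.
have he : h * (A + 3) <= e by rewrite -ler_pdivlMr// ge_min lexx orbT.
have [T0 [_ HT]] := cA h h0.
have [T Ta TT0] : exists2 T, a <= T & T0 < T.
  exists (Num.max (T0 + 1) a); first by rewrite le_max lexx orbT.
  by rewrite lt_max; apply/orP; left; lra.
pose M s := fine (m (dball dist x s)).
have ME s : m (dball dist x s) = (M s)%:E.
  by rewrite fineK// ge0_fin_numE.
have M0 s : 0 <= M s by rewrite fine_ge0.
have Mmono s t : s <= t -> M s <= M t.
  move=> st; rewrite -lee_fin -!ME; apply: le_measure; rewrite ?inE//.
  by move=> y; rewrite /dball/= => /lt_le_trans; apply.
pose N s := fine (m (annulus x s)).
have NE s : m (annulus x s) = (N s)%:E.
  by rewrite fineK// ge0_fin_numE// (le_lt_trans (annulus_le x s)).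
have N0 s : 0 <= N s by rewrite fine_ge0.
have NM s : N s <= M s by rewrite -lee_fin -ME -NE annulus_le.
have MN s : M s <= N s + M a.
  rewrite -lee_fin EFinD -!ME -NE.
  apply: le_trans (measureU2 m (mannulus x s) (mball x a)); apply: le_measure; rewrite ?inE//.
    exact: measurableU.
  move=> y; rewrite /dball/annulus/= => ys.
  by have [ay|ya] := leP a (dist x y); [left|right].
have Va0 : 0 <= V a by rewrite ltW// V_gt0.
have MV s : T <= s -> (A - h) * V s <= M s <= (A + h) * V s.
  move=> Ts; have s0 : 0 < s := lt_le_trans a0 (le_trans Ta Ts).
  have := HT s (lt_le_trans TT0 Ts).
  rewrite ME -EFinM !lee_fin ler_pdivlMr ?ler_pdivrMr ?V_gt0//.
have a_gt0 := a0.
have Vmon s : a < s -> V a <= V s by move=> /ltW; apply: V_mono; lra.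
(* These constants absorb the radii between [a] and [T], where the density limit says nothing, as
   well as the terms in [V a] and [M a] due to removing the inner ball. *)
pose b1 := (A + h) * V a + M T.
pose b2 := h * V a + M a + A * V T.
have b10 : 0 <= b1 by rewrite addr_ge0// mulr_ge0// addr_ge0// ltW.
have VT0 : 0 <= V T by apply: V_ge0; lra.
have b20 : 0 <= b2 by rewrite !addr_ge0// mulr_ge0// ltW.
have up s : a < s -> N s <= (A + h) * (V s - V a) + b1.
  move=> a_s; have := NM s; have [Ts|sT] := leP T s.
    by have /andP[_] := MV s Ts; have := M0 T; rewrite /b1; lra.
  have := Mmono _ _ (ltW sT); have := Vmon s a_s; rewrite /b1.
  have : 0 <= (A + h) * V s by rewrite mulr_ge0 ?V_ge0//; lra.
  lra.
have low s : a < s -> A * (V s - V a) <= N s + h * (V s - V a) + b2.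
  move=> a_s; have := MN s; have AVa : 0 <= A * V a by rewrite mulr_ge0.
  have AVT : 0 <= A * V T by rewrite mulr_ge0.
  have [Ts|sT] := leP T s.
    by have /andP[+ _] := MV s Ts; rewrite /b2; lra.
  have : V s <= V T by apply: V_mono; lra.
  move=> /(ler_wpM2l A0); have := M0 a; have := N0 s.
  have : 0 <= h * V s by rewrite mulr_ge0 ?V_ge0//; lra.
  rewrite /b2; lra.
have small b : \forall n \near \oo, b * rt n a <= h.
  have : b * rt n a @[n --> \oo] --> b * 0 by apply: cvgMr; exact: rt0.
  rewrite mulr0 => /cvgrPdist_le/(_ _ h0); apply: filterS => n.
  by rewrite sub0r normrN ler_norml => /andP[].
have I1 := (cvge_within _ _).1 mass1 _ h0.
have s1 := small b1; have s2 := small b2.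
near=> n.
have s1n : b1 * rt n a <= h by near: n.
have s2n : b2 * rt n a <= h by near: n.
have /andP[Il Iu] : ((1 - h)%:E <= tail_mass V (rt n) a <= (1 + h)%:E)%E.
  by near: n; exact: I1.
have U : (1%:E * tail_average n x + 0%:E * tail_mass V (rt n) a <=
   0%:E * tail_average n x + (A + h)%:E * tail_mass V (rt n) a + (b1 * rt n a)%:E)%E.
  apply: (@comparison n x 1 0 0 (A + h) b1 a) => //; first by lra.
  move=> s a_s; rewrite mul1e mul0r adde0 mul0e add0e.
  by rewrite [X in (X <= _)%E](NE s) -EFinD lee_fin; exact: up.
have L : (0%:E * tail_average n x + A%:E * tail_mass V (rt n) a <=
   1%:E * tail_average n x + h%:E * tail_mass V (rt n) a + (b2 * rt n a)%:E)%E.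
  apply: (@comparison n x 0 A 1 h b2 a) => //; first by lra.
  move=> s a_s; rewrite mul1e mul0e add0e.
  by rewrite [X in (_ <= X + _ + _)%E](NE s) -!EFinD lee_fin; exact: low.
move: U L; rewrite !mul1e !mul0e adde0 !add0e.
case: (tail_mass V (rt n) a) Il Iu => [I| |]//; rewrite !lee_fin => Il Iu.
case: (tail_average n x) => [F| |]//; rewrite -!EFinM -!EFinD !lee_fin => U L.
by apply/andP; split; nra.
Unshelve. all: by end_near. Qed.

End radial_averages.

(** * Weighted double integrals of symmetric kernels *)

Section symmetric_kernels.
Local Open Scope ereal_scope.
Context {R : realType} {disp : measure_display} {X : measurableType disp}.
Variables (m : {sigma_finite_measure set X -> \bar R}) (Q : nat -> X * X -> R).
Hypothesis mQ : forall n, measurable_fun setT (Q n).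
Hypothesis Q0 : forall n z, (0 <= Q n z)%R.
Hypothesis Qsym : forall n x y, Q n (x, y) = Q n (y, x).
Variables (A K : R).
Hypothesis A0 : (0 <= A)%R.
Hypothesis K0 : (0 <= K)%R.
Hypothesis Q_cvg : forall x, \int[m]_y (Q n (x, y))%:E @[n --> \oo] --> A%:E.
Hypothesis Q_bound : \forall n \near \oo, forall x, \int[m]_y (Q n (x, y))%:E <= K%:E.
Variable f : X -> R.
Hypothesis mf : measurable_fun setT f.
Hypothesis f0 : forall x, (0 <= f x)%R.
Hypothesis f_int : \int[m]_x (f x)%:E < +oo.

Let average n x := \int[m]_y (Q n (x, y))%:E.

Let mEQ n : measurable_fun setT (EFin \o Q n).
Proof. exact/measurable_EFinP. Qed.

Let maverage n : measurable_fun setT (average n).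
Proof.
have q0 z : 0 <= (EFin \o Q n) z by rewrite lee_fin.
exact: (measurable_fun_fubini_tonelli_F (m2 := m) _ (mEQ n) q0).
Qed.

Let average0 n x : 0 <= average n x.
Proof. by apply: integral_ge0 => y _; rewrite lee_fin. Qed.

Let mEf : measurable_fun setT (EFin \o f).
Proof. exact/measurable_EFinP. Qed.

(** Dominated convergence, with [K * f] as the bound. *)
Lemma cvg_weighted_average :
  \int[m]_x ((f x)%:E * average n x) @[n --> \oo] -->
    A%:E * \int[m]_x (f x)%:E.
Proof.
have [N _ QN] := Q_bound.
(* The bound on the averages holds only from index [N] on, while dominated convergence asks for it
   at every index. *)
rewrite -(cvg_shiftn N) /=.
have -> : A%:E * \int[m]_x (f x)%:E = \int[m]_x ((f x)%:E * A%:E).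
  rewrite -ge0_integralZl//; first by apply: eq_integral => x _; rewrite muleC.
  by move=> x _; rewrite lee_fin.
apply: (@dominated_cvg _ _ _ m setT measurableT
  (fun n x => (f x)%:E * average (n + N) x) _ (fun x => K%:E * (f x)%:E)) => //.
- by move=> n; apply: emeasurable_funM.
- by move=> x _; apply: cvgeZl => //; rewrite (cvg_shiftn N (average ^~ x)); exact: Q_cvg.
- apply/integrableP; split; first exact: measurable_funeM.
  under eq_integral => x _ do rewrite gee0_abs ?mule_ge0 ?lee_fin//.
  rewrite ge0_integralZl//; last by move=> x _; rewrite lee_fin.
  by rewrite lte_mul_pinfty.
- move=> n x _; rewrite gee0_abs; last by rewrite mule_ge0 ?lee_fin.
  rewrite muleC; apply: lee_wpmul2r; rewrite ?lee_fin//.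
  by apply: QN => /=; exact: leq_addl.
Qed.

(** Integrating first in the variable that [f] does not see, and using the symmetry of [Q], shows
    that the terms in [f z.1] and [f z.2] have equal integrals. This is the origin of the factor
    2. *)
Lemma cvg_symmetric_average :
  \int[m \x m]_z ((f z.1 + f z.2) * Q n z)%:E @[n --> \oo] -->
    (2 * A)%:E * \int[m]_x (f x)%:E.
Proof.
have m1 n : measurable_fun setT (fun z : X * X => (f z.1 * Q n z)%:E).
  by apply/measurable_EFinP; apply: measurable_funM => //; exact: measurableT_comp.
have m2 n : measurable_fun setT (fun z : X * X => (f z.2 * Q n z)%:E).
  by apply/measurable_EFinP; apply: measurable_funM => //; exact: measurableT_comp.
have n1 n z : 0 <= (f z.1 * Q n z)%:E by rewrite lee_fin mulr_ge0.
have n2 n z : 0 <= (f z.2 * Q n z)%:E by rewrite lee_fin mulr_ge0.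
have inner n x : \int[m]_y (f x * Q n (x, y))%:E = (f x)%:E * average n x.
  under eq_integral => y _ do rewrite EFinM.
  rewrite ge0_integralZl//.
  - apply/measurable_EFinP.
    exact: (measurableT_comp (mQ n) (measurable_pair1 x)).
  - by move=> y _; rewrite lee_fin.
  - by rewrite lee_fin.
have e1 n : \int[m \x m]_z (f z.1 * Q n z)%:E = \int[m]_x ((f x)%:E * average n x).
  rewrite fubini_tonelli1//; apply: eq_integral => x _.
  exact: inner.
have e2 n : \int[m \x m]_z (f z.2 * Q n z)%:E = \int[m]_x ((f x)%:E * average n x).
  rewrite fubini_tonelli1// /fubini_F (fubini_tonelli _ (m2 n))//.
  apply: eq_integral => y _; rewrite -inner; apply: eq_integral => x _ /=.
  by rewrite Qsym.
have -> : (fun n => \int[m \x m]_z ((f z.1 + f z.2) * Q n z)%:E) =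
    (fun n => 2%:E * \int[m]_x ((f x)%:E * average n x)).
  apply/funext => n; under eq_integral => z _ do rewrite mulrDl EFinD.
  by rewrite ge0_integralD// e1 e2 mule_natl mule2n.
rewrite EFinM -muleA; apply: cvgeZl => //; exact: cvg_weighted_average.
Qed.

End symmetric_kernels.

(** * The normalization condition at a fixed radius *)

Section mass_at_infinity.
Context {R : realType} (V : R -> R) (rt : nat -> R -> R).
Hypothesis V_incr : forall s t : R, 0 <= s -> s < t -> V s < V t.
Hypothesis V_derivable : forall t : R, 0 < t -> derivable V t 1.
Hypothesis dV_continuous : {in `]0, +oo[, continuous (derive1 V)}.
Hypothesis Vy : V t @[t --> +oo] --> +oo.
Hypothesis rt_decr : forall n, forall r s : R, 0 < r -> r < s -> rt n s < rt n r.
Hypothesis rt_derivable : forall n (r : R), 0 < r -> derivable (rt n) r 1.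
Hypothesis rtV0 : forall n, rt n r * V r @[r --> +oo] --> 0.
Hypothesis rt0 : forall r, 0 < r -> rt n r @[n --> \oo] --> 0.

Let rt_gt0 n := profile_gt0 Vy (@rt_decr n) (rtV0 n).

(** On [[a, b[] the profile is at most [rt n a], and [V'] integrates to [V b - V a]. *)
Lemma tail_mass_split n (a b : R) : 0 < a -> a < b ->
  (tail_mass V (rt n) b <= tail_mass V (rt n) a <=
   tail_mass V (rt n) b + ((V b - V a) * rt n a)%:E)%E.
Proof.
move=> a_gt0 ab.
have mVr : measurable_fun [set` `[a, +oo[] (fun r => (derive1 V r * rt n r)%:E).
  apply/measurable_EFinP; apply: measurable_funM.
  - apply: measurable_funS (measurable_volume_derive dV_continuous) => //.
    by move=> r /=; rewrite !in_itv/= !andbT; lra.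
  - apply: measurable_funS (measurable_profile (@rt_derivable n)) => //.
    by move=> r /=; rewrite !in_itv/= !andbT; lra.
have Vr0 r : a <= r -> (0 <= (derive1 V r * rt n r)%:E)%E.
  move=> ar; have r0 : 0 < r by lra.
  rewrite lee_fin mulr_ge0//; first exact: volume_derive_ge0.
  exact/ltW/rt_gt0.
have subr : [set` `[b, +oo[] `<=` [set` `[a, +oo[].
  by move=> r /=; rewrite !in_itv/= !andbT; lra.
have subl : [set` `[a, b]] `<=` [set` `[a, +oo[].
  by move=> r /=; rewrite !in_itv/= !andbT => /andP[].
have subl' : [set` `[a, b[] `<=` [set` `[a, +oo[].
  by move=> r /=; rewrite !in_itv/= !andbT => /andP[].
apply/andP; split.
  apply: ge0_subset_integral => // r; rewrite /= in_itv/= andbT; exact: Vr0.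
have e : [set` `[a, +oo[] = [set` `[a, b[] `|` [set` `[b, +oo[].
  by rewrite -itv_bndbnd_setU// bnd_simp ltW.
rewrite {1}/tail_mass e ge0_integral_setU//; first last.
- apply/disj_setPRL => r /=; rewrite !in_itv/= andbT => br.
  by apply/negP; rewrite negb_and -!leNgt br orbT.
- by move=> r; rewrite -e/= in_itv/= andbT; exact: Vr0.
- by rewrite -e.
rewrite addeC leeD2l//.
have -> : ((V b - V a) * rt n a)%:E =
    (\int[lebesgue_measure]_(r in `[a, b[) ((rt n a)%:E * (derive1 V r)%:E))%E.
  rewrite ge0_integralZl//.
  - rewrite integral_itv_bndo_bndc ?integral_volume_derive//; last first.
      apply/measurable_EFinP.
      apply: measurable_funS (measurable_volume_derive dV_continuous) => //.
      by move=> r /=; rewrite !in_itv/= !andbT; lra.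
    by rewrite -EFinM mulrC.
  - apply/measurable_EFinP.
    apply: measurable_funS (measurable_volume_derive dV_continuous) => //.
    by move=> r /=; rewrite !in_itv/= !andbT; lra.
  - move=> r /=; rewrite in_itv/= lee_fin => /andP[ar _].
    by apply: volume_derive_ge0 => //; lra.
  - by rewrite lee_fin ltW// rt_gt0.
apply: ge0_le_integral => //.
- by move=> r /= /subl'; rewrite /= in_itv/= andbT; exact: Vr0.
- exact: measurable_funS mVr.
- apply: measurable_funeM; apply/measurable_EFinP.
  apply: measurable_funS (measurable_volume_derive dV_continuous) => //.
  by move=> r /=; rewrite !in_itv/= !andbT; lra.
move=> r /=; rewrite in_itv/= -EFinM lee_fin mulrC => /andP[ar _].
apply: ler_wpM2r; first by apply: volume_derive_ge0 => //; lra.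
exact: profile_nonincr (@rt_decr n) _ _ _ _.
Qed.

(* The mass carried by a bounded interval vanishes in the limit, so the inner
   limit of the normalization condition does not depend on the radius. *)
Lemma cvg_tail_mass (L : R -> \bar R) :
  (\forall a \near +oo, tail_mass V (rt n) a @[n --> \oo] --> L a) ->
  L a @[a --> +oo] --> 1%E ->
  exists R1, forall a, R1 < a -> tail_mass V (rt n) a @[n --> \oo] --> 1%E.
Proof.
move=> [M [_ HM]] L1; exists (Num.max M 0) => a.
rewrite gt_max => /andP[Ma a_gt0].
have La b : a < b -> L a = L b.
  move=> ab.
  have Mb : M < b by lra.
  have ca := HM a Ma; have cb := HM b Mb.
  suff cab : tail_mass V (rt n) a @[n --> \oo] --> L b by exact: (cvg_unique _ ca cab).
  have cr : ((V b - V a) * rt n a)%:E @[n --> \oo] --> 0%E.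
    apply: cvg_EFin; first by near=> n.
    have -> : 0 = (V b - V a) * 0 :> R by rewrite mulr0.
    by apply: cvgMr; exact: rt0.
  have cbr : (tail_mass V (rt n) b + ((V b - V a) * rt n a)%:E)%E @[n --> \oo] --> L b.
    rewrite -[X in _ --> X]adde0; apply: cvgeD => //.
    by rewrite fin_num_adde_defl.
  by apply: (squeeze_cvge _ cb cbr); near=> n; exact: tail_mass_split.
(* [L] takes the constant value [L a] beyond [a], so its limit 1 at infinity is that value. *)
have L1' : L b @[b --> +oo] --> L a.
  apply: cvg_near_cst; near=> b; apply/esym/La.
  by near: b; apply: nbhs_pinfty_gt; rewrite num_real.
by have := HM a Ma; rewrite (cvg_unique _ L1' L1).
Unshelve. all: by end_near. Qed.

End mass_at_infinity.

(** * Limit of the energies *)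

(** The value 0 at radius 0 encodes the removal of the diagonal, so that energies become integrals
    over the whole product. *)
Definition punctured {R : realType} (rho : R -> R) : R -> R :=
  fun r => if 0 < r then rho r else 0.

Definition core_profile {R : realType} (rho : R -> R) (a : R) : R -> R :=
  fun r => if 0 < r < a then rho r else 0.

Lemma punctured_split {R : realType} (rho : R -> R) (a r : R) : 0 < a ->
  punctured rho r = core_profile rho a r + tail_profile rho a r.
Proof.
rewrite /punctured /core_profile /tail_profile => a0.
have [r0|r0] := ltP 0 r; last by rewrite ifF ?add0r//=; apply/negbTE; rewrite -ltNge; lra.
by have [ra|ra] /= := ltP r a; rewrite ?addr0 ?add0r.
Qed.

(** Dominated convergence with bound [f]: at each [x] the integrand vanishes once [n > g x]. With
    [g] the distance to a point, an integrable [f] has small integral outside large balls. *)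
Lemma integral_tail_cvg0 {R : realType} {disp} {X : measurableType disp}
    (m : {measure set X -> \bar R}) (g f : X -> R) :
  measurable_fun setT g -> measurable_fun setT f -> (forall x, 0 <= f x) ->
  (\int[m]_x (f x)%:E < +oo)%E ->
  (\int[m]_x (if g x < n%:R then 0 else f x)%:E)%E @[n --> \oo] --> 0%E.
Proof.
move=> mg mf f0 fi.
have -> : 0%E = (\int[m]_x (cst 0 x))%E :> \bar R by rewrite integral0.
apply: (@dominated_cvg _ _ _ m setT measurableT
  (fun n x => (if g x < n%:R then 0 else f x)%:E) _ (EFin \o f)) => //.
- by move=> n; apply/measurable_EFinP; apply: measurable_fun_ifT => //; exact: measurable_fun_ltr.
- move=> x _; apply: cvg_near_cst; near=> n.
  rewrite ifT//; near: n; exact: nbhs_infty_gtr.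
- apply/integrableP; split; first exact/measurable_EFinP.
  by under eq_integral => x _ do rewrite /= ger0_norm//.
- by move=> n x _; rewrite /= lee_fin; case: ifP => _; rewrite ?normr0// ger0_norm.
Unshelve. all: by end_near. Qed.

Section energy_limit.
Context {R : realType} {disp : measure_display} {X : measurableType disp}.
Variables (dist : X -> X -> R) (m : {sigma_finite_measure set X -> \bar R}).
Hypothesis mball : forall x r, measurable (dball dist x r).
Hypothesis mdist : measurable_fun setT (fun z : X * X => dist z.1 z.2).
Hypothesis dist_sym : forall x y, dist x y = dist y x.
Hypothesis dist_tri : forall x y z, dist x z <= dist x y + dist y z.
Hypothesis ball_fin : forall x r, (m (dball dist x r) < +oo)%E.

Variables (V : R -> R) (rt : nat -> R -> R).
Hypothesis V_ge0 : forall t : R, 0 <= t -> 0 <= V t.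
Hypothesis V_incr : forall s t : R, 0 <= s -> s < t -> V s < V t.
Hypothesis V_derivable : forall t : R, 0 < t -> derivable V t 1.
Hypothesis dV_continuous : {in `]0, +oo[, continuous (derive1 V)}.
Hypothesis Vy : V t @[t --> +oo] --> +oo.
Hypothesis rt_decr : forall n, forall r s : R, 0 < r -> r < s -> rt n s < rt n r.
Hypothesis rt_derivable : forall n (r : R), 0 < r -> derivable (rt n) r 1.
Hypothesis rtV0 : forall n, rt n r * V r @[r --> +oo] --> 0.
Hypothesis rt0 : forall r, 0 < r -> rt n r @[n --> \oo] --> 0.
Hypothesis rt_ratio : forall n k, (k < n)%N -> forall r s : R, 0 < r -> r <= s ->
  rt n r / rt k r <= rt n s / rt k s.
Variable R1 : R.
Hypothesis mass1 : forall a, R1 < a -> tail_mass V (rt n) a @[n --> \oo] --> 1%E.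
Variables (k R0 A : R) (x0 : X).
Hypothesis k0 : 0 <= k.
Hypothesis mk : forall r, R0 <= r -> forall x, (m (dball dist x r) <= (k * V r)%:E)%E.
Hypothesis A0 : 0 <= A.
Hypothesis density : forall x,
  (m (dball dist x r) * ((V r)^-1)%:E)%E @[r --> +oo] --> A%:E.

Let rt_gt0 n := profile_gt0 Vy (@rt_decr n) (rtV0 n).
Let d (z : X * X) := dist z.1 z.2.

Let mtail n a : 0 < a -> measurable_fun setT (fun z => tail_profile (rt n) a (d z)).
Proof.
move=> a_gt0.
exact: (measurableT_comp (measurable_tail_profile (@rt_derivable n) a_gt0) mdist).
Qed.

Let tail0 n a r : 0 < a -> 0 <= tail_profile (rt n) a r.
Proof. by move=> a_gt0; exact: (tail_profile_ge0 Vy (@rt_decr n) (rtV0 n)). Qed.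

Let core0 n a r : 0 <= core_profile (rt n) a r.
Proof. by rewrite /core_profile; case: ifP => // /andP[r0 _]; exact/ltW/rt_gt0. Qed.

Let mcore n a : measurable_fun setT (fun z => core_profile (rt n) a (d z)).
Proof.
apply: (measurableT_comp (f := core_profile (rt n) a) _ mdist).
apply: measurable_fun_if => //.
- by apply: measurable_and; exact: measurable_fun_ltr.
- apply: measurable_funS (measurable_profile (@rt_derivable n)) => //.
  by move=> r [_ /=] /andP[r0 _]; rewrite in_itv/= r0.
Qed.

Lemma punctured_ge0 n r : 0 <= punctured (rt n) r.
Proof. by rewrite (punctured_split _ _ ltr01) addr_ge0// tail0. Qed.

Lemma measurable_punctured_dist n :
  measurable_fun setT (fun z : X * X => punctured (rt n) (dist z.1 z.2)).
Proof.
rewrite (_ : (fun _ => _) = (fun z =>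
  core_profile (rt n) 1 (d z) + tail_profile (rt n) 1 (d z))).
  by apply: measurable_funD => //; exact: mtail.
by apply/funext => z; exact: punctured_split.
Qed.

(** For [0 < r < a] and [n > n0], monotonicity of the ratio gives
    [rt n r <= rt n a / rt n0 a * rt n0 r], and [rt n a] tends to 0. The finiteness of one energy
    enters here. *)
Lemma cvg_core_energy (D : X * X -> R) (a : R) (n0 : nat) : 0 < a ->
  measurable_fun setT D -> (forall z, 0 <= D z) ->
  (\int[m \x m]_z (D z * punctured (rt n0) (d z))%:E < +oo)%E ->
  (\int[m \x m]_z (D z * core_profile (rt n) a (d z))%:E)%E @[n --> \oo] --> 0%E.
Proof.
move=> a_gt0 mD D0 E0; set E := (X in (X < _)%E) in E0.
have EE : E = (fine E)%:E.
  rewrite fineK// ge0_fin_numE//; apply: integral_ge0 => z _.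
  by rewrite lee_fin mulr_ge0// punctured_ge0.
have c0 : (rt n a / rt n0 a * fine E)%:E @[n --> \oo] --> 0%E.
  apply: cvg_EFin; first by near=> n.
  have -> : 0 = 0 / rt n0 a * fine E :> R by rewrite !mul0r.
  by apply: cvgMl; apply: cvgMl; exact: rt0.
apply: (squeeze_cvge _ (cvg_cst 0%E) c0).
near=> n; apply/andP; split.
  by apply: integral_ge0 => z _; rewrite lee_fin mulr_ge0.
rewrite EFinM -EE -ge0_integralZl//; last 3 first.
- apply/measurable_EFinP; apply: measurable_funM => //.
  exact: measurable_punctured_dist.
- by move=> z _; rewrite lee_fin mulr_ge0// punctured_ge0.
- by rewrite lee_fin divr_ge0// ltW// rt_gt0.
apply: ge0_le_integral => //.
- by move=> z _; rewrite lee_fin mulr_ge0.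
- by apply/measurable_EFinP; exact: measurable_funM.
- apply: measurable_funeM; apply/measurable_EFinP; apply: measurable_funM => //.
  exact: measurable_punctured_dist.
move=> z _; rewrite -EFinM lee_fin mulrCA; apply: ler_wpM2l => //.
rewrite /core_profile /punctured; case: ifPn => [/andP[r0 ra]|_].
  rewrite r0 -ler_pdivrMr ?rt_gt0//; apply: rt_ratio => //; last exact: ltW.
  by near: n; exact: nbhs_infty_gt.
rewrite mulr_ge0 ?divr_ge0 ?(ltW (rt_gt0 _ _))//.
by case: ifP => // r0; exact/ltW/rt_gt0.
Unshelve. all: by end_near. Qed.

Lemma cvg_far_average (f : X -> R) (a : R) : 0 < a -> R0 <= a -> R1 < a ->
  measurable_fun setT f -> (forall x, 0 <= f x) -> (\int[m]_x (f x)%:E < +oo)%E ->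
  (\int[m \x m]_z ((f z.1 + f z.2) * tail_profile (rt n) a (d z))%:E)%E
    @[n --> \oo] --> ((2 * A)%:E * \int[m]_x (f x)%:E)%E.
Proof.
move=> a_gt0 R0a R1a mf f0 fi.
have c1 := mass1 R1a.
apply: (@cvg_symmetric_average _ _ _ m
  (fun n z => tail_profile (rt n) a (d z)) _ _ _ A (k * 2 + 1)) => //.
- by move=> n; exact: mtail.
- by move=> n z; exact: tail0.
- by move=> n x y; rewrite /d/= dist_sym.
- by rewrite addr_ge0// mulr_ge0.
- move=> x; exact: (@cvg_tail_average _ _ _ dist m mball mdist ball_fin V rt
    V_ge0 V_incr V_derivable dV_continuous Vy rt_decr rt_derivable rtV0 rt0 a a_gt0 c1).
- exact: (@tail_average_bound _ _ _ dist m mball mdist V rt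
    V_ge0 V_incr V_derivable dV_continuous Vy rt_decr rt_derivable rtV0 rt0 a a_gt0 c1 k R0).
Qed.

(** The choices are made in this order: [c] and [e], then the constant [C] of the pointwise
    inequality, then the radius [M], then the cut [a], and finally [n]. *)
Lemma cvg_radial_energy (p : R) (u : X -> R) (n0 : nat) : 0 < p ->
  measurable_fun setT u -> (\int[m]_x (`|u x| `^ p)%:E < +oo)%E ->
  (\int[m \x m]_z (`|u z.1 - u z.2| `^ p * punctured (rt n0) (d z))%:E < +oo)%E ->
  (\int[m \x m]_z (`|u z.1 - u z.2| `^ p * punctured (rt n) (d z))%:E)%E
    @[n --> \oo] --> ((2 * A)%:E * \int[m]_x (`|u x| `^ p)%:E)%E.
Proof.
move=> p0 mu ui E0.
pose f x := `|u x| `^ p.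
pose D (z : X * X) := `|u z.1 - u z.2| `^ p.
have f0 x : 0 <= f x by exact: powR_ge0.
have D0 z : 0 <= D z by exact: powR_ge0.
have mf : measurable_fun setT f.
  by apply: (measurableT_comp (measurable_powR p)); exact: measurableT_comp.
have mD : measurable_fun setT D.
  apply: (measurableT_comp (measurable_powR p)); apply: measurableT_comp => //.
  by apply: measurable_funB; exact: measurableT_comp.
have If : (\int[m]_x (f x)%:E)%E = (fine (\int[m]_x (f x)%:E))%:E.
  by rewrite fineK// ge0_fin_numE// integral_ge0// => x _; rewrite lee_fin.
rewrite [X in (_ * X)%E]If -EFinM.
set l := 2 * A * _.
have l0 : 0 <= l.
  rewrite !mulr_ge0// fine_ge0// integral_ge0// => x _; by rewrite lee_fin.
apply: cvge_multiplicative_squeeze => // c e c1 e0.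
have [C C0 HC] := powR_diff_bounds p0 c1.
pose w M x := if dist x0 x < M then 0 else f x.
have w0 M x : 0 <= w M x by rewrite /w; case: ifP.
have mdx : measurable_fun setT (dist x0).
  exact: (measurableT_comp mdist (measurable_pair1 x0)).
have mw M : measurable_fun setT (w M).
  by apply: measurable_fun_ifT => //; exact: measurable_fun_ltr.
have wf M x : w M x <= f x by rewrite /w; case: ifP.
have wi M : (\int[m]_x (w M x)%:E < +oo)%E.
  apply: le_lt_trans ui; apply: ge0_le_integral => //.
  - by move=> x _; rewrite lee_fin.
  - exact/measurable_EFinP.
  - exact/measurable_EFinP.
  - by move=> x _; rewrite lee_fin.
have Iw M : (\int[m]_x (w M x)%:E)%E = (fine (\int[m]_x (w M x)%:E))%:E.
  by rewrite fineK// ge0_fin_numE// integral_ge0// => x _; rewrite lee_fin.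
(* [M] depends on [C], so that the limit of the minimum term, multiplied by [C], is at most [e / 4].
   The 1 in the denominator covers [C * 2 * A = 0]. *)
have [M M_ge0 hM] : exists2 M, 0 <= M & C * (2 * A * fine (\int[m]_x (w M x)%:E)%E) <= e / 4.
  have h0 : 0 < e / 4 / (C * 2 * A + 1).
    by rewrite divr_gt0// ?divr_gt0// ltr_wpDl// !mulr_ge0.
  have /cvge_within/(_ _ h0)[N _ HN] := integral_tail_cvg0 mdx mf f0 ui.
  exists N%:R => //; have /andP[_] := HN N (leqnn N).
  rewrite add0r [X in (X <= _)%E]Iw lee_fin ler_pdivlMr; last first.
    by rewrite ltr_wpDl// !mulr_ge0.
  have : 0 <= fine (\int[m]_x (w N%:R x)%:E)%E.
    by rewrite fine_ge0// integral_ge0// => x _; rewrite lee_fin.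
  lra.
(* The three entries give the uniform ball bound from [a] on, the convergence of the tail mass at
   [a], and the separation [2 * M < a]. *)
pose a := Num.max (Num.max R0 (R1 + 1)) (2 * M + 1).
have R0a : R0 <= a by rewrite !le_max lexx.
have R1a : R1 < a by rewrite !lt_max ltrDl ltr01 orbT.
have Ma : 2 * M < a by rewrite !lt_max ltrDl ltr01 !orbT.
have a_gt0 : 0 < a by rewrite (le_lt_trans _ Ma)// mulr_ge0.
pose t n z := tail_profile (rt n) a (d z).
have t0 n z : 0 <= t n z by exact: tail0.
have mt n : measurable_fun setT (t n) by exact: mtail.
pose far n := (\int[m \x m]_z (D z * t n z)%:E)%E.
pose near0 n := (\int[m \x m]_z (D z * core_profile (rt n) a (d z))%:E)%E.
pose G n := (\int[m \x m]_z ((f z.1 + f z.2) * t n z)%:E)%E.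
pose H n := (\int[m \x m]_z ((w M z.1 + w M z.2) * t n z)%:E)%E.
have split_energy n : (\int[m \x m]_z (`|u z.1 - u z.2| `^ p *
    punctured (rt n) (d z))%:E = near0 n + far n)%E.
  rewrite -ge0_integralD//.
  - by apply: eq_integral => z _; rewrite -EFinD -mulrDr -punctured_split.
  - by move=> z _; rewrite lee_fin mulr_ge0.
  - by apply/measurable_EFinP; exact: measurable_funM.
  - by move=> z _; rewrite lee_fin mulr_ge0.
  - by apply/measurable_EFinP; exact: measurable_funM.
have cG : G n @[n --> \oo] --> l%:E.
  by rewrite EFinM -If; exact: cvg_far_average.
have cH : H n @[n --> \oo] --> (2 * A * fine (\int[m]_x (w M x)%:E))%:E.
  by rewrite EFinM -Iw; exact: cvg_far_average.
have cN : near0 n @[n --> \oo] --> 0%E by exact: cvg_core_energy E0.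
(* Two points at distance at least [a > 2 M] cannot both lie in the ball of
   radius [M] about [x0]. *)
have wmin n z : Num.min (f z.1) (f z.2) * t n z <= (w M z.1 + w M z.2) * t n z.
  rewrite /t /tail_profile; case: ifPn => [az|_]; last by rewrite !mulr0.
  apply: ler_wpM2r; first by apply/ltW/rt_gt0; exact: lt_le_trans az.
  have := dist_tri z.1 x0 z.2; rewrite (dist_sym z.1 x0) => tz.
  have [z1M|Mz1] := ltP (dist x0 z.1) M; last first.
    have -> : w M z.1 = f z.1 by rewrite /w ltNge Mz1.
    by apply: (@le_trans _ _ (f z.1)); [rewrite ge_min lexx|rewrite lerDl].
  have Mz2 : M <= dist x0 z.2.
    by rewrite leNgt; apply/negP => z2M; move: az; rewrite /d; lra.
  have -> : w M z.2 = f z.2 by rewrite /w ltNge Mz2.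
  by apply: (@le_trans _ _ (f z.2)); [rewrite ge_min lexx orbT|rewrite lerDr].
(* Integrated form of both pointwise inequalities; it is applied twice, with [D] and [f z.1 + f z.2]
   exchanging roles. *)
have cmb (g1 g2 g3 : X * X -> R) n : measurable_fun setT g1 ->
    measurable_fun setT g2 -> measurable_fun setT g3 ->
    (forall z, 0 <= g1 z) -> (forall z, 0 <= g2 z) -> (forall z, 0 <= g3 z) ->
    (forall z, g1 z * t n z <= (c * g2 z) * t n z + C * (g3 z * t n z)) ->
    (\int[m \x m]_z (g1 z * t n z)%:E <=
     c%:E * \int[m \x m]_z (g2 z * t n z)%:E + C%:E * \int[m \x m]_z (g3 z * t n z)%:E)%E.
  move=> m1 m2 m3 p1 p2 p3 h.
  have q (g : X * X -> R) : measurable_fun setT g ->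
      measurable_fun setT (fun z : X * X => (g z * t n z)%:E).
    by move=> mg; apply/measurable_EFinP; exact: measurable_funM.
  have q0 (g : X * X -> R) z : (forall z, 0 <= g z) -> (0 <= (g z * t n z)%:E)%E.
    by move=> g0; rewrite lee_fin mulr_ge0.
  have c0 : 0 <= c by lra.
  rewrite -ge0_integralZl//; [|exact: q|by move=> z _; exact: q0].
  rewrite -ge0_integralZl//; [|exact: q|by move=> z _; exact: q0].
  rewrite -ge0_integralD//; first last.
  - by apply: measurable_funeM; exact: q.
  - by move=> z _; rewrite mule_ge0// q0.
  - by apply: measurable_funeM; exact: q.
  - by move=> z _; rewrite mule_ge0// q0.
  apply: ge0_le_integral => //.
  - by move=> z _; exact: q0.
  - exact: q.
  - by apply: emeasurable_funD; apply: measurable_funeM; exact: q.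
  by move=> z _; rewrite -!EFinM -EFinD lee_fin mulrA.
have mf2 : measurable_fun setT (fun z : X * X => f z.1 + f z.2).
  by apply: measurable_funD; exact: measurableT_comp.
have mw2 : measurable_fun setT (fun z : X * X => w M z.1 + w M z.2).
  by apply: measurable_funD; exact: measurableT_comp.
have up n : (far n <= c%:E * G n + C%:E * H n)%E.
  apply: cmb => //; [by move=> z; rewrite addr_ge0|by move=> z; rewrite addr_ge0|].
  move=> z; apply: le_trans (lerD (lexx _) (ler_wpM2l C0 (wmin n z))).
  by rewrite mulrA -mulrDl; apply: ler_wpM2r => //; case: (HC (u z.1) (u z.2)).
have low n : (G n <= c%:E * far n + C%:E * H n)%E.
  apply: cmb => //; [by move=> z; rewrite addr_ge0|by move=> z; rewrite addr_ge0|].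
  move=> z; apply: le_trans (lerD (lexx _) (ler_wpM2l C0 (wmin n z))).
  by rewrite mulrA -mulrDl; apply: ler_wpM2r => //; case: (HC (u z.1) (u z.2)).
(* In the upper bound [G] contributes its error [c] times, [H] contributes [C] times and the near
   part once, for a total of [e / 4]; the lower bound costs no more. *)
pose h := e / 4 / (c + C + 1).
have cC : 0 < c + C + 1 by lra.
have h0 : 0 < h by rewrite /h !divr_gt0.
have hE : h * (c + C + 1) = e / 4 by rewrite /h divfK// gt_eqF.
have nG := (cvge_within _ _).1 cG _ h0.
have nH := (cvge_within _ _).1 cH _ h0.
have nN := (cvge_within _ _).1 cN _ h0.
set Hlim := 2 * A * _ in hM nH.
near=> n.
have /andP[Gl Gu] : ((l - h)%:E <= G n <= (l + h)%:E)%E by near: n; exact: nG.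
have /andP[Hl Hu] : ((Hlim - h)%:E <= H n <= (Hlim + h)%:E)%E by near: n; exact: nH.
have /andP[Nl Nu] : ((0 - h)%:E <= near0 n <= (0 + h)%:E)%E by near: n; exact: nN.
rewrite split_energy.
have N0 : (0 <= near0 n)%E.
  by apply: integral_ge0 => z _; rewrite lee_fin mulr_ge0.
have := up n; have := low n.
case: (near0 n) N0 Nu {Nl} => [N| |]//; rewrite add0r !lee_fin => N0 Nu.
case: (G n) Gl Gu => [g| |]//; rewrite !lee_fin => Gl Gu.
case: (H n) Hl Hu => [hh| |]//; rewrite !lee_fin => Hl Hu.
rewrite -!EFinM -!EFinD.
case: (far n) => [F| |]//; last by rewrite gt0_muleNy ?lte_fin//; lra.
rewrite -!EFinM -!EFinD !lee_fin => lw upp.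
have c_ge0 : 0 <= c by lra.
have cg := ler_wpM2l c_ge0 Gu; have CH := ler_wpM2l C0 Hu.
have cN0 := mulr_ge0 c_ge0 N0; have Ch := mulr_ge0 C0 (ltW h0).
have ch := mulr_ge0 c_ge0 (ltW h0).
rewrite !mulrDr in cg CH hE *; split; lra.
Unshelve. all: by end_near. Qed.

End energy_limit.

(** * Passage to the product measure and conclusion *)

(** Off the diagonal the distance is positive, so puncturing changes nothing; on the diagonal the
    integrand vanishes because [p != 0] makes [0 ^ p = 0]. Tonelli then joins the iterated
    integrals. *)
Lemma nonlocal_energyE {R : realType} {disp : measure_display}
    {X : measurableType disp} (dist : X -> X -> R)
    (m : {sigma_finite_measure set X -> \bar R}) (p : R) (rho : R -> R) (u : X -> R) :
  is_metric dist -> p != 0 -> measurable_fun setT u ->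
  (forall r, 0 <= punctured rho r) ->
  measurable_fun setT (fun z : X * X => punctured rho (dist z.1 z.2)) ->
  nonlocal_energy dist m p rho u =
  (\int[m \x m]_z (`|u z.1 - u z.2| `^ p * punctured rho (dist z.1 z.2))%:E)%E.
Proof.
move=> [d0 deq _ _] p0 mu rho0 mrho.
have mD : measurable_fun setT (fun z : X * X => `|u z.1 - u z.2| `^ p).
  apply: (measurableT_comp (measurable_powR p)); apply: measurableT_comp => //.
  by apply: measurable_funB; exact: measurableT_comp.
have mg : measurable_fun setT (fun z : X * X =>
    (`|u z.1 - u z.2| `^ p * punctured rho (dist z.1 z.2))%:E).
  by apply/measurable_EFinP; exact: measurable_funM.
have g0 (z : X * X) :
    (0 <= (`|u z.1 - u z.2| `^ p * punctured rho (dist z.1 z.2))%:E)%E.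
  by rewrite lee_fin mulr_ge0// powR_ge0.
rewrite fubini_tonelli1// /fubini_F (fubini_tonelli _ mg g0).
apply: eq_integral => y _; rewrite integral_mkcond; apply: eq_integral => x _.
rewrite patchE /=; case: ifPn => [|xy].
  rewrite inE/= => xy; congr (_ * _)%:E; rewrite /punctured ifT// lt_neqAle d0 andbT.
  by apply/eqP => /esym/deq.
have -> : x = y by move: xy; rewrite notin_setE/= => /contrapT.
by rewrite subrr normr0 powR0// mul0r.
Qed.

Theorem mainTheorem4 (R : realType) (disp : measure_display)
  (X : measurableType disp) (dist : X -> X -> R)
  (m : {measure set X -> \bar R}) (V : R -> R) (AVR : \bar R)
  (rt : nat -> R -> R) (p : R) (u : X -> R) :
  admissible_V V ->
  metric_measure_space dist m ->
  is_AVR dist m V AVR ->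
  (exists2 k : R, 0 < k & exists R0 : R, forall r, R0 <= r -> forall x,
      (m (dball dist x r) <= (k * V r)%:E)%E) ->
  approx_identity_radial V rt ->
  1 <= p ->
  in_Lp m p u ->
  (exists n0 : nat, (nonlocal_energy dist m p (rt n0) u < +oo)%E) ->
  nonlocal_energy dist m p (rt n) u @[n --> \oo] -->
    (2%:E * AVR * Lp_norm_pow m p u)%E.
Proof.
move=> [V0 Vincr [Vd Vc] _ Vy] [dm [_ [sep [bor _]]]] [A0 cA] [k k0 [R0 mk]].
move=> [rdecr [rdiff [r0 [rV [rratio [L [cL L1]]]]]]] p1 [mu ui] [n0 E0].
(* On an empty space the density condition holds for any nonnegative [AVR], even [+oo]; all
   integrals vanish and the limit is [AVR] times 0, which is 0. *)
have [[x0 _]|Xe] := pselect (exists x : X, True); last first.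
  have int0 (g : X -> \bar R) : (\int[m]_x g x)%E = 0%E.
    by apply: integral0_eq => x _; exfalso; apply: Xe; exists x.
  rewrite /Lp_norm_pow int0 mule0; apply: cvg_near_cst; near=> n.
  by rewrite /nonlocal_energy int0.
have mball := measurable_dball dm bor.
have mdist := measurable_dist dm sep bor.
have [d0 _ dsym dtri] := dm.
(* The growth bound starts at radius [R0], so smaller balls are enlarged first. *)
have ball_fin x r : (m (dball dist x r) < +oo)%E.
  apply: (@le_lt_trans _ _ (k * V (Num.max r R0))%:E); last by rewrite ltry.
  apply: (@le_trans _ _ (m (dball dist x (Num.max r R0)))); last first.
    by apply: mk; rewrite le_max lexx orbT.
  apply: le_measure; rewrite ?inE//.
  by move=> y; rewrite /dball/= => /lt_le_trans; apply; rewrite le_max lexx.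
(* Balls of integer radius about [x0] cover the space. Tonelli needs this as structure, so [m] is
   repackaged as a sigma-finite measure [m'] with the same values. *)
have sf : sigma_finite setT m.
  exists (fun n => dball dist x0 n%:R); last by move=> n; split.
  apply/esym/seteqP; split => // x _.
  near \oo => n; exists n => //; rewrite /dball/=; near: n; exact: nbhs_infty_gtr.
pose m_sfinite := isSFinite.Build _ _ _ _ (sfinite_measure_sigma_finite sf).
pose m_sigma_finite := isSigmaFinite.Build _ _ _ _ sf.
pose m' : {sigma_finite_measure set X -> \bar R} :=
  HB.pack_for (SigmaFiniteMeasure.type X R) (Measure.sort m)
    m_sfinite m_sigma_finite.
have mE : m = m' by exact: eq_measure.
(* An infinite density would push the ratio above [k + 1], while the growth bound keeps it below [k]
   for large radii. *)
have [A AE] : exists A : R, AVR = A%:E.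
  case: AVR A0 cA => [A| |] A0 cA; [by exists A| |by []].
  have /cvgeyPge/(_ (k + 1)) cy := cA x0.
  exfalso; near (pinfty_nbhs R) => r.
  have : ((k + 1)%:E <= m (dball dist x0 r) * ((V r)^-1)%:E)%E by near: r.
  apply/negP; rewrite -ltNge.
  have R0r : R0 <= r by near: r; apply: nbhs_pinfty_ge; rewrite num_real.
  have r_gt0 : 0 < r by near: r; apply: nbhs_pinfty_gt; rewrite num_real.
  have Vr : 0 < V r by apply: le_lt_trans (Vincr _ _ (lexx 0) r_gt0); exact: V0.
  apply: (@le_lt_trans _ _ ((k * V r)%:E * ((V r)^-1)%:E)%E).
    by apply: lee_wpmul2r; [rewrite lee_fin invr_ge0 ltW|exact: mk].
  by rewrite -EFinM lte_fin mulfK ?gt_eqF// ltrDl.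
subst AVR.
have rd1 n r : 0 < r -> derivable (rt n) r 1 by case: (rdiff n) => + _; exact.
have [R1 mass1] := cvg_tail_mass Vincr Vd Vc Vy rdecr rd1 rV r0 cL L1.
have p_gt0 : 0 < p by lra.
have q0 n r : 0 <= punctured (rt n) r.
  by rewrite /punctured; case: ifP => // r_gt0; apply/ltW/(profile_gt0 Vy (@rdecr n)).
have mq n := measurable_punctured_dist mdist rd1 n.
have EE n : nonlocal_energy dist m' p (rt n) u =
    (\int[m' \x m']_z (`|u z.1 - u z.2| `^ p * punctured (rt n) (dist z.1 z.2))%:E)%E.
  by apply: nonlocal_energyE => //; rewrite gt_eqF.
have mk' r : R0 <= r -> forall x, (m' (dball dist x r) <= (k * V r)%:E)%E.
  exact: mk.
have ball_fin' x r : (m' (dball dist x r) < +oo)%E by exact: ball_fin.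
have cA' x : (m' (dball dist x r) * ((V r)^-1)%:E)%E @[r --> +oo] --> A%:E.
  exact: cA.
move: E0 ui; rewrite mE EE => E0 ui.
under eq_fun do rewrite EE.
rewrite -EFinM.
exact: (cvg_radial_energy mball mdist dsym dtri ball_fin' V0 Vincr Vd Vc Vy
  rdecr rd1 rV r0 rratio mass1 x0 (ltW k0) mk' A0 cA' p_gt0 mu ui E0).
Unshelve. all: by end_near. Qed.
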